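(* Let $\Gamma=(N,A,\hat I,\prec,\hat\chi,\gamma,u)$ be a spacetime game with perfect information, and let $\hat I_1,\dots,\hat I_n$ be any linearization of $\Gamma$. Then the tuple $\hat\Gamma=(N,A,H,Z,\chi,\rho,\sigma,u,I)$ constructed from $\Gamma$ and this linearization (as defined in the context) is a game in extensive form with imperfect information. Furthermore, $\hat\Gamma$ has the same strategic form as $\Gamma$ (under the identification of each information set $I_l$ of $\hat\Gamma$ with the decision point $\hat I_l$ of $\Gamma$): each agent has the same strategy space in both games, and each strategy profile yields the same payoffs in both games.
   Context: **Spacetime games.** Minkowski spacetime is $\mathbb{R}^d$ ($d\ge 2$, usually $d=4$) with a flat metric of signature $(d-1,1)$; write its points as $(x,t)$ with $x\in\mathbb{R}^{d-1}$, $t\in\mathbb{R}$ (units with speed of light 1). A raw assignment is a partial function $\alpha$ from $\hat I$ to $A$ with $\alpha(P)\in\hat\chi(P)$ wherever it is defined; $\alpha(P)=\perp$ means undefined at $P$. A raw assignment $\alpha$ is a restriction of $\beta$ (and $\beta$ an extension of $\alpha$) if $\alpha(P)\ne\perp$ implies $\alpha(P)=\beta(P)$, for all $P$. A spacetime game with perfect information is a tuple $\Gamma=(N,A,\hat I,\prec,\hat\chi,\gamma,u)$ where: - $N$ is a set of agents and $A$ a set of actions; - $\hat I$ is a finite set of decision points $\hat I_{i,j}$, where $i\in N$ is the agent deciding at $\hat I_{i,j}$ and $j\in\mathbb{N}$ is an index; each has a location $\mathcal{L}(\hat I_{i,j})\in\mathbb{R}^d$; - $\prec$ (timelike precedence)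 is the relation induced by the locations: for decision points $P,Q$ with locations $(x_P,t_P)$ and $(x_Q,t_Q)$, $P\prec Q$ iff the locations are different and $t_Q-t_P\ge\|x_Q-x_P\|$ (lightlike separation counts as timelike; colocated points count as spacelike-separated); - $\hat\chi:\hat I\to\mathcal{P}(A)$ gives the (nonempty) set of actions available at each decision point; - $\gamma$ associates with each decision point $P$ its contingency coordinates $\gamma_P$, a raw assignment defined only on decision points $Q\prec P$. Say that $Q$ actually precedes $P$ if $Q\prec P$ and $\gamma_Q$ is a restriction of $\gamma_P$. The contingency coordinates are required to be consistent: for all $P,Q\in\hat I$, $\gamma_P(Q)\neq\perp$ if and only if $Q$ actually precedes $P$; - $u$ assigns a real number (payoff) to each agent and complete history, where complete histories are defined next. A history is a raw assignment $h$ such that for all decision points $P,Q$: if $h(P)\ne\perp$ and $\gamma_P(Q)\neq\perp$ then $h(Q)=\gamma_P(Q)$. A history is complete if no history that assigns actions to strictly more decision points extends it; otherwise it is incomplete. A strategy of agent $i$ in $\Gamma$ is a raw assignment defined exactly on the decision points of agent $i$; a strategy profile is the union of one strategy per agent, i.e. a raw assignment defined on all of $\hat I$. For every strategy profile there is a unique complete history that is a restriction of it; the strategic form of $\Gamma$ is the normal-form game with these strategy spaces in which a strategy profile yields the payoffs of that complete history. **Games in extensive form with imperfect information.** Such a game is a tuple $(N,A,H,Z,\chi,\rho,\sigma,u,I)$ where $N$ is a set of players, $A$ a set of actions, $H$ a set of choice nodes, $Z$ a set of outcomes, $\chi:H\to\mathcal{P}(A)$ gives the available actions, $\rho:H\to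 N$ the player at each node, $\sigma$ is the successor function mapping pairs $(h,a)\in H\times A$ to $H\cup Z$, defined only if $a\in\chi(h)$, injective, and organizing $H\cup Z$ as a single tree (one connected component with a single root), $u$ assigns a real payoff to each player and outcome, and $I$ is a partition of $H$ into information sets (each indexed by a player $i$ and an integer $j$) such that $\rho(h)=i$ for all $h\in I_{i,j}$ and $\chi(h)=\chi(h')$ for all $h,h'\in I_{i,j}$. Its strategic form: a strategy of player $i$ chooses an available action at each information set of $i$; a strategy profile determines a play from the root to an outcome, whose payoffs are the payoffs of the profile. **Construction.** A linearization of $\Gamma$ is a listing $\hat I_1,\dots,\hat I_n$ of all decision points such that $P\prec Q$ implies $P$ is listed before $Q$. A history $h$ is a prefix of a history $h'$ if there is an integer $k$ such that $h$ and $h'$ match exactly on the first $k$ decision points and $h$ leaves all decision points beyond the $k$-th unassigned. $Z$ is the set of all complete histories; $H$ is the set of all incomplete histories that are a prefix of a complete history. $H\cup Z$ is given the tree structure that is the transitive reduction of the prefix relation (a parent is a prefix of its children). For each $h\in H$, all children of $h$ differ from $h$ exactly by assigning an action to one and the same decision point, denoted $\hat I(h)$. Define: $\rho(h)$ is the agent deciding at $\hat I(h)$; $\chi(h)=\hat\chi(\hat I(h))$; for $a\in\chi(h)$, $\sigma(h,a)$ is the history obtained from $h$ by assigning $a$ to $\hat I(h)$; $I$ is the partition of $H$ into the sets $I_l=\{h\in H:\hat I(h)=\hat I_l\}$, where $I_l$ inherits the double index $(i,j)$ of $\hat I_l=\hat I_{i,j}$; $u$ is the utility function of $\Gamma$ (defined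 on agents and complete histories). *)

(* Defs.v *)
From HB Require Import structures.
From Stdlib Require Import Relation_Operators.
From mathcomp Require Import all_boot all_order all_algebra.
From mathcomp Require Import all_classical all_reals.

Set Implicit Arguments.
Unset Strict Implicit.
Unset Printing Implicit Defensive.

Import Order.TTheory GRing.Theory Num.Theory.
Local Open Scope classical_set_scope.
Local Open Scope ring_scope.

(* The norm that the library puts on row vectors is the sup norm. *)
Definition euclidean_norm (R : realType) (m : nat) (x : 'rV[R]_m) : R :=
  Num.sqrt (\sum_(i < m) x ord0 i ^+ 2).

(* Minkowski spacetime R^d: d - 1 spatial coordinates, then time. *)
Definition spacetime (R : realType) (d : nat) : Type := ('rV[R]_d.-1 * R)%type.

Definition timelike_precedes (R : realType) (d : nat) (p q : spacetime R d) :
    Prop :=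
  p <> q /\ euclidean_norm (q.1 - p.1) <= q.2 - p.2.

(* A partial function from D to A, with None for "undefined". *)
Definition assignment (D A : Type) : Type := D -> option A.

Definition raw_assignment (D A : Type) (avail : D -> set A)
    (alpha : assignment D A) : Prop :=
  forall P a, alpha P = Some a -> avail P a.

Definition restriction (D A : Type) (alpha beta : assignment D A) : Prop :=
  forall P, alpha P <> None -> alpha P = beta P.

(* Everything in a spacetime game except the payoffs, whose domain (the
   complete histories) is defined from these data. *)
Record spacetime_arena (R : realType) (d : nat) (N A : Type) := SpacetimeArena {
  dpoint : finType;
  agent : dpoint -> N;
  dindex : dpoint -> nat;
  dindexP : forall P Q, agent P = agent Q -> dindex P = dindex Q -> P = Q;
  location : dpoint -> spacetime R d;
  avail : dpoint -> set A;
  avail_neq0 : forall P, avail P !=set0;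
  contingency : dpoint -> assignment dpoint A;
  contingency_raw : forall P, raw_assignment avail (contingency P);
  contingency_past : forall P Q, contingency P Q <> None ->
    timelike_precedes (location Q) (location P);
  contingency_consistent : forall P Q, contingency P Q <> None <->
    timelike_precedes (location Q) (location P) /\
    restriction (contingency Q) (contingency P)
}.

Definition precedes (R : realType) (d : nat) (N A : Type)
    (G : spacetime_arena R d N A) (P Q : dpoint G) : Prop :=
  timelike_precedes (location P) (location Q).

Definition history (R : realType) (d : nat) (N A : Type)
    (G : spacetime_arena R d N A) (h : assignment (dpoint G) A) : Prop :=
  raw_assignment (@avail _ _ _ _ G) h /\
  forall P Q, h P <> None -> contingency P Q <> None -> h Q = contingency P Q.

Definition complete_history (R : realType) (d : nat) (N A : Type)
    (G : spacetime_arena R d N A) (h : assignment (dpoint G) A) : Prop :=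
  history h /\
  ~ exists h', [/\ history h', restriction h h' &
                   exists P, h P = None /\ h' P <> None].

Record spacetime_game (R : realType) (d : nat) (N A : Type) := SpacetimeGame {
  arena :> spacetime_arena R d N A;
  payoff : N -> {h : assignment (dpoint arena) A | complete_history h} -> R
}.

Record normal_form (R : realType) (N X : Type) := NormalForm {
  nf_strategy : N -> set X;
  nf_payoff : (forall i, {s : X | nf_strategy i s}) -> N -> R
}.

Definition strategy (R : realType) (d : nat) (N A : Type)
    (G : spacetime_arena R d N A) (i : N) : set (assignment (dpoint G) A) :=
  [set s | raw_assignment (@avail _ _ _ _ G) s /\
           forall P, s P <> None <-> agent P = i].

(* F is the strategic form of G. *)
Definition strategic_form (R : realType) (d : nat) (N A : Type)
    (G : spacetime_game R d N A)
    (F : normal_form R N (assignment (dpoint G) A)) : Prop :=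
  (forall i, nf_strategy F i = strategy (G := G) i) /\
  forall s : (forall i, {x | nf_strategy F i x}),
    exists z : {h : assignment (dpoint G) A | complete_history h},
      unique (fun z' : {h : assignment (dpoint G) A | complete_history h} =>
        restriction (sval z') (fun P => sval (s (agent P)) P)) z /\
      forall i, nf_payoff s i = payoff i z.

Arguments strategic_form {R d N A} G F.

(* The data of a game in extensive form with imperfect information. The type
   ef_info indexes the information sets; ef_player k and ef_num k are the
   double index of the information set ef_infoset k. *)
Record extensive_tuple (R : realType) (N A : Type) := ExtensiveTuple {
  ef_choice : Type;
  ef_outcome : Type;
  ef_avail : ef_choice -> set A;
  ef_agent : ef_choice -> N;
  ef_succ : ef_choice -> A -> option (ef_choice + ef_outcome);
  ef_payoff : N -> ef_outcome -> R;
  ef_info : Type;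
  ef_player : ef_info -> N;
  ef_num : ef_info -> int;
  ef_infoset : ef_info -> set ef_choice
}.

Definition ef_node (R : realType) (N A : Type) (E : extensive_tuple R N A) :
    Type := (ef_choice E + ef_outcome E)%type.

Definition ef_edge (R : realType) (N A : Type) (E : extensive_tuple R N A)
    (x y : ef_node E) : Prop :=
  exists h a, x = inl h /\ ef_succ h a = Some y.

Definition ef_root (R : realType) (N A : Type) (E : extensive_tuple R N A)
    (r : ef_node E) : Prop :=
  ~ exists x, ef_edge x r.

Record extensive_game (R : realType) (N A : Type) (E : extensive_tuple R N A) :
    Prop := ExtensiveGame {
  ef_succ_defined : forall (h : ef_choice E) a,
    ef_succ h a <> None <-> ef_avail h a;
  ef_succ_inj : forall (h h' : ef_choice E) a a' y,
    ef_succ h a = Some y -> ef_succ h' a' = Some y -> h = h' /\ a = a';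
  (* With the uniqueness of parents (ef_succ_inj), a parentless r from which
     every node is reachable makes the successor graph a single rooted tree. *)
  ef_tree : exists r : ef_node E,
    unique (@ef_root _ _ _ E) r /\
    forall x, clos_refl_trans _ (@ef_edge _ _ _ E) r x;
  ef_infoset_neq0 : forall k : ef_info E, ef_infoset k !=set0;
  ef_infoset_partition : forall h : ef_choice E, exists! k, ef_infoset k h;
  ef_info_index : forall k k' : ef_info E,
    ef_player k = ef_player k' -> ef_num k = ef_num k' -> k = k';
  ef_infoset_agent : forall (k : ef_info E) h,
    ef_infoset k h -> ef_agent h = ef_player k;
  ef_infoset_avail : forall (k : ef_info E) h h',
    ef_infoset k h -> ef_infoset k h' -> ef_avail h = ef_avail h'
}.

Definition ef_strategy (R : realType) (N A : Type) (E : extensive_tuple R N A)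
    (i : N) : set (assignment (ef_info E) A) :=
  [set s | (forall k, s k <> None <-> ef_player k = i) /\
           forall k a h, s k = Some a -> ef_infoset k h -> ef_avail h a].

(* The edges chosen by the profile s. *)
Definition ef_follows (R : realType) (N A : Type) (E : extensive_tuple R N A)
    (s : N -> assignment (ef_info E) A) (x y : ef_node E) : Prop :=
  exists h k a, [/\ x = inl h, ef_infoset k h,
                    s (ef_agent h) k = Some a & ef_succ h a = Some y].

Definition ef_reaches (R : realType) (N A : Type) (E : extensive_tuple R N A)
    (s : N -> assignment (ef_info E) A) (z : ef_outcome E) : Prop :=
  exists r, ef_root r /\ clos_refl_trans _ (ef_follows s) r (inr z).

(* F is the strategic form of E. *)
Definition ef_strategic_form (R : realType) (N A : Type)
    (E : extensive_tuple R N A)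
    (F : normal_form R N (assignment (ef_info E) A)) : Prop :=
  (forall i, nf_strategy F i = ef_strategy (E := E) i) /\
  forall s : (forall i, {x | nf_strategy F i x}),
    exists z : ef_outcome E,
      unique (ef_reaches (fun i => sval (s i))) z /\
      forall i, nf_payoff s i = ef_payoff i z.

Arguments ef_strategic_form {R N A} E F.

Record linearization (R : realType) (d : nat) (N A : Type)
    (G : spacetime_arena R d N A) := Linearization {
  listing :> seq (dpoint G);
  listing_uniq : uniq listing;
  listing_all : forall P, P \in listing;
  listing_precedes : forall P Q, precedes P Q ->
    (index P listing < index Q listing)%N
}.

Section Construction.
Context (R : realType) (d : nat) (N A : Type) (G : spacetime_arena R d N A).
Context (L : linearization G).
Implicit Types (h z : assignment (dpoint G) A) (P Q : dpoint G).

Definition history_prefix h h' : Prop :=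
  exists k : nat, (forall P, (index P L < k)%N -> h P = h' P) /\
                  (forall P, (k <= index P L)%N -> h P = None).

Definition choice_node h : Prop :=
  [/\ history h, ~ complete_history h &
      exists z, complete_history z /\ history_prefix h z].

Definition tree_node h : Prop := choice_node h \/ complete_history h.

(* The transitive reduction of the prefix relation, that is, its covering
   relation. *)
Definition child h h' : Prop :=
  [/\ tree_node h, tree_node h', history_prefix h h', h <> h' &
      forall g, tree_node g -> history_prefix h g -> history_prefix g h' ->
        g = h \/ g = h'].

Definition assign h P (a : A) : assignment (dpoint G) A :=
  fun Q => if Q == P then Some a else h Q.

(* P is the one decision point to which every child of h assigns an action. *)
Definition decides_at h P : Prop :=
  (exists h', child h h') /\
  forall h', child h h' ->
    [/\ h P = None, h' P <> None & forall Q, Q != P -> h' Q = h Q].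

Lemma contingency_rank P Q : contingency P Q <> None ->
  (index Q L < index P L)%N.
Proof. by move=> /contingency_past; apply: listing_precedes. Qed.

Lemma complete_defined z P : complete_history z ->
  z P <> None <-> restriction (contingency P) z.
Proof.
move=> [[zraw zcont] zmax]; split=> [zP Q cQ|cz zP]; first by rewrite (zcont P).
apply: zmax; have [a aP] := avail_neq0 P.
exists (assign z P a); split; last by exists P; rewrite /assign eqxx.
- split=> [Q b|Q S]; rewrite /assign.
    by case: eqVneq => [-> [<-]//|_]; apply: zraw.
  case: eqVneq => [->|QP] zQ cQS.
    case: eqVneq => [SP|SP]; last by rewrite (cz _ cQS).
    by move: cQS => /contingency_rank; rewrite SP ltnn.
  case: eqVneq => [SP|SP]; last exact: zcont.
  by move: (zcont _ _ zQ cQS); rewrite SP zP => e; case: cQS; rewrite SP -e.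
- by move=> Q; rewrite /assign; case: eqVneq => // ->; rewrite zP.
Qed.

Definition truncate z (k : nat) : assignment (dpoint G) A :=
  fun P => if (index P L < k)%N then z P else None.

Lemma prefix_truncate z k : history_prefix (truncate z k) z.
Proof.
by exists k; split=> P; rewrite /truncate; [move=> ->|rewrite ltnNge => ->].
Qed.

Lemma prefixE h z : history_prefix h z -> exists k, h = truncate z k.
Proof.
move=> [k [h1 h2]]; exists k; apply/funext => P; rewrite /truncate.
by case: ltnP => kP; [apply: h1|apply: h2].
Qed.

Lemma truncate_truncate z i j : truncate (truncate z i) j = truncate z (minn j i).
Proof.
by apply/funext => P; rewrite /truncate leq_min; case: (_ < j)%N => //=.
Qed.

Lemma truncate_node z k : complete_history z -> tree_node (truncate z k).
Proof.
move=> zC; have [[zraw zcont] _] := zC.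
have hh : history (truncate z k).
  split=> [P a|P Q]; rewrite /truncate; case: ifP => // Pk; first exact: zraw.
  by move=> zP c; rewrite (ltn_trans (contingency_rank c) Pk); apply: zcont.
case: (pselect (complete_history (truncate z k))) => C; [by right|left].
by split=> //; exists z; split=> //; apply: prefix_truncate.
Qed.

Lemma node_truncate h : tree_node h ->
  exists z k, complete_history z /\ h = truncate z k.
Proof.
case=> [[_ _ [z [zC /prefixE[k ->]]]]|hC]; first by exists z, k.
exists h, (size L); split=> //; apply/funext => P.
by rewrite /truncate index_mem listing_all.
Qed.

Lemma truncate_le z i j : (i <= j)%N -> history_prefix (truncate z i) (truncate z j).
Proof.
move=> ij; have -> : truncate z i = truncate (truncate z j) i.
  by rewrite truncate_truncate (minn_idPl ij).
exact: prefix_truncate.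
Qed.

Lemma choice_node_decides h : choice_node h -> exists P, decides_at h P.
Proof.
move=> hN; have [hh hI [z [zC /prefixE[k hz]]]] := hN.
have [P [zP hP iminP]] : exists P, [/\ z P <> None, h P = None &
    forall Q, (index Q L < index P L)%N -> z Q = h Q].
  have /existsP[P0 P0P] : [exists P, (z P : bool) && ~~ (h P)].
    apply: contrapT => /negP; rewrite negb_exists => /forallP nP.
    apply: hI; suff -> : h = z by [].
    apply/funext => P; move: (nP P); rewrite hz /truncate.
    by case: ifP => // _; case: (z P).
  have [P /andP[zP hP] Pmin] := @arg_minnP _ P0 (fun P => z P && ~~ h P) (fun P => index P L) P0P.
  exists P; split; [by move: zP; case: (z P)|by move: hP; case: (h P)|].
  move=> Q QP; move: (Pmin Q); rewrite leqNgt QP hz /truncate.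
  case: ifP => // _; case: (z Q) => //= b /(_ isT) //.
have agree z' k' : complete_history z' -> h = truncate z' k' ->
    forall Q, (index Q L < index P L)%N -> z' Q = h Q.
  move=> z'C hz' Q; have [n] := ubnP (index Q L).
  elim: n Q => // n IH Q /ltnSE Qn QP.
  have [Qk'|Qk'] := ltnP (index Q L) k'; first by rewrite hz' /truncate Qk'.
  have hQ : h Q = None by rewrite hz' /truncate ltnNge Qk'.
  rewrite hQ; apply: contrapT => z'Q.
  suff : z Q <> None by rewrite iminP.
  apply/(complete_defined _ zC) => S cS; have SQ := contingency_rank cS.
  rewrite ((complete_defined Q z'C).1 z'Q _ cS) iminP ?(ltn_trans SQ)//.
  by apply: IH; [apply: leq_trans SQ Qn|apply: ltn_trans SQ QP].
have defP z' k' : complete_history z' -> h = truncate z' k' -> z' P <> None.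
  move=> z'C hz'; apply/(complete_defined _ z'C) => S cS.
  have SP := contingency_rank cS.
  by rewrite (agree z' k')// -iminP// ((complete_defined P zC).1 zP _ cS).
have above z' k' : complete_history z' -> h = truncate z' k' ->
    h = truncate z' (index P L).
  move=> z'C hz'; apply/funext => Q; case: (ltnP (index Q L) (index P L)) => QP.
    by rewrite /truncate QP (agree z' k').
  rewrite [RHS]/truncate ltnNge QP /= hz' /truncate; case: ifP => // Qk'.
  case: (defP _ _ z'C hz'); rewrite -hP hz' /truncate.
  by rewrite (leq_ltn_trans QP Qk').
pose m z' := truncate z' (index P L).+1.
have mP z' : m z' P = z' P by rewrite /m /truncate ltnSn.
have mQ z' k' Q : complete_history z' -> h = truncate z' k' ->
    Q != P -> m z' Q = h Q.
  move=> z'C hz' QP; rewrite (above _ _ z'C hz') /m /truncate ltnS leq_eqVlt.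
  case: eqP => //= /(congr1 (nth P L)); rewrite !nth_index ?listing_all//.
  by move=> e; rewrite e eqxx in QP.
exists P; split.
  exists (m z); split; [by left|exact: truncate_node| | |].
  - by rewrite (above _ _ zC hz); apply: truncate_le.
  - by move=> /(congr1 (@^~ P)); rewrite mP hP => /esym.
  - move=> g gN hg /prefixE[j]; rewrite /m truncate_truncate => gE.
    have [jP|jP] := leqP j (index P L).
      left; move: hg => /prefixE[i hi]; move: gE.
      rewrite (minn_idPl _) ?(leq_trans jP)// => gE.
      apply/funext => Q; case: (pselect (h Q = None)) => hQ.
        rewrite hQ gE /truncate; case: ifP => // Qj.
        by rewrite iminP// (leq_trans Qj).
      by rewrite hi /truncate; case: ifP => // Qi; case: hQ; rewrite hi /truncate Qi.
    by right; rewrite gE (minn_idPr jP).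
move=> h' [_ h'N /prefixE[i hh'] hneq hmin].
have [z' [j [z'C h'E]]] := node_truncate h'N.
have hz' : h = truncate z' (minn i j) by rewrite hh' h'E truncate_truncate.
have Pj : (index P L < j)%N.
  rewrite ltnNge; apply/negP => jP; apply: hneq; rewrite h'E.
  apply/funext => Q; rewrite hh' h'E truncate_truncate.
  have [Qj|Qj] := ltnP (index Q L) j; last first.
    by rewrite /truncate leq_min !(ltnNge _ j) Qj andbF.
  rewrite -hz' -(agree _ _ z'C hz') ?(leq_trans Qj)//.
  by rewrite /truncate Qj.
have : m z' = h'.
  have [] // := hmin (m z').
  - exact: truncate_node.
  - by rewrite (above _ _ z'C hz'); apply: truncate_le.
  - by rewrite h'E; apply: truncate_le.
  - by move=> /(congr1 (@^~ P)); rewrite mP hP => /(defP _ _ z'C hz').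
move=> <-; split=> //; first by rewrite mP; apply: defP z'C hz'.
by move=> Q; apply: mQ z'C hz'.
Qed.

Definition decision_point (h : {h | choice_node h}) : dpoint G :=
  sval (cid (choice_node_decides (svalP h))).

Definition to_node h :
    option ({h | choice_node h} + {h | complete_history h}) :=
  match pselect (choice_node h), pselect (complete_history h) with
  | left hN, _ => Some (inl (exist _ h hN))
  | _, left hC => Some (inr (exist _ h hC))
  | _, _ => None
  end.

End Construction.

Definition extensive_of (R : realType) (d : nat) (N A : Type)
    (G : spacetime_game R d N A) (L : linearization G) :
    extensive_tuple R N A := {|
  ef_choice := {h | choice_node L h};
  ef_outcome := {h : assignment (dpoint G) A | complete_history h};
  ef_avail := fun h => avail (decision_point h);
  ef_agent := fun h => agent (decision_point h);
  ef_succ := fun h a =>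
    if `[< avail (decision_point h) a >]
    then to_node L (assign (sval h) (decision_point h) a) else None;
  ef_payoff := fun i z => payoff i z;
  (* An information set is indexed by the decision point that its nodes share;
     this is the identification under which the strategic forms are compared. *)
  ef_info := dpoint G;
  ef_player := fun P => agent P;
  ef_num := fun P => (dindex P)%:Z;
  ef_infoset := fun P => [set h | decision_point h = P]
|}.

(* Main.v *)
(** A complete history is determined by its actions: it is defined at [P]
    exactly when it extends the contingency coordinates of [P], and these live
    on earlier points of the linearization. Hence a strategy profile is resolved
    into a complete history by recursion along the linearization, and two
    complete histories can first differ only at a point where both are defined.
    A choice node is a complete history cut just before a point where it is
    defined, and its children are the cuts just after that point, one for each
    available action. *)

From Stdlib Require Import Relation_Operators Operators_Properties.
Require Import Defs.
From mathcomp Require Import all_boot all_order all_algebra.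
From mathcomp Require Import all_classical all_reals.

Set Implicit Arguments.
Unset Strict Implicit.
Unset Printing Implicit Defensive.

(** * Complete histories and the profiles that generate them *)

Section Histories.
Context (R : realType) (d : nat) (N A : Type) (G : spacetime_arena R d N A).
Context (L : linearization G).
Implicit Types (h z S : assignment (dpoint G) A) (P Q : dpoint G).

Lemma index_listing_inj P Q : index P L = index Q L -> P = Q.
Proof.
by move=> /(congr1 (nth P L)); rewrite !nth_index ?listing_all.
Qed.

(** Agreement before [Q] makes [z] and [z'] meet the criterion of [complete_defined] at [Q] together
    or not at all, so only values at points where both are defined need comparing. *)
Lemma complete_agree z z' k : complete_history z -> complete_history z' ->
  (forall Q a b, (index Q L < k)%N -> z Q = Some a -> z' Q = Some b -> a = b) ->
  forall Q, (index Q L < k)%N -> z Q = z' Q.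
Proof.
move=> zC z'C ab Q; have [n] := ubnP (index Q L).
elim: n Q => // n IH Q /ltnSE Qn Qk.
have below P : (contingency Q P <> None) -> z P = z' P.
  move=> /(contingency_rank L) PQ.
  by apply: IH; [apply: leq_trans Qn|apply: ltn_trans Qk].
have def : z Q <> None <-> z' Q <> None.
  split=> [/(complete_defined L Q zC)|/(complete_defined L Q z'C)] c;
    [apply/(complete_defined L Q z'C)|apply/(complete_defined L Q zC)] => P cP.
    by rewrite c// below.
  by rewrite c// -below.
case zQ: (z Q) => [a|]; case z'Q: (z' Q) => [b|] //.
- by rewrite (ab Q a b).
- by case: def => /(_ ltac:(by rewrite zQ)) + _; rewrite z'Q.
- by case: def => _ /(_ ltac:(by rewrite z'Q)); rewrite zQ.
Qed.

Lemma complete_restriction_inj S z z' :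
  complete_history z -> complete_history z' ->
  restriction z S -> restriction z' S -> z = z'.
Proof.
move=> zC z'C zS z'S; apply/funext => P.
apply: (complete_agree zC z'C (k := (index P L).+1)) => // Q a b _ zQ z'Q.
have : Some a = Some b by rewrite -zQ -z'Q zS ?zQ// z'S// z'Q.
by case.
Qed.

(** An extension [h'] defined at a point [P] missed by [z] follows the coordinates of [P]. As [z]
    does not extend them, it misses one of their points, and the descent continues at that earlier
    point. *)
Lemma completeI z : history z ->
  (forall P, restriction (contingency P) z -> z P <> None) ->
  complete_history z.
Proof.
move=> zh zdef; split=> // -[h' [[_ h'c] zh' [P [zP h'P]]]].
have [n] := ubnP (index P L).
elim: n P zP h'P => // n IH P zP h'P /ltnSE Pn.
apply: zdef (zP) => Q cQ; have h'Q := h'c _ _ h'P cQ.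
case: (pselect (z Q = None)) => zQ; last by rewrite zh'.
exfalso; apply: (IH Q) => //; first by rewrite h'Q.
by apply: leq_trans Pn; apply: contingency_rank cQ.
Qed.

(** The recursion is posed as an operator on whole assignments: for a total raw assignment [S], its
    fixed points are the complete histories that restrict [S]. *)
Definition resolve S z : assignment (dpoint G) A :=
  fun P => if `[< restriction (contingency P) z >] then S P else None.

Lemma eq_resolve S z z' P :
  (forall Q, (index Q L < index P L)%N -> z Q = z' Q) ->
  resolve S z P = resolve S z' P.
Proof.
move=> e; rewrite /resolve; congr (if _ then _ else _).
by apply: asbool_equiv_eq; split=> c Q cQ; rewrite c// e//;
  apply: contingency_rank cQ.
Qed.

Lemma resolve_fixpoint S : exists z, resolve S z = z.
Proof.
pose zn n := iter n (resolve S) (fun=> None).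
(* After more than [index P L] iterations the value at [P] is final, since it depends only on
   earlier points. *)
have stab n m P : (index P L < n)%N -> (index P L < m)%N -> zn n P = zn m P.
  elim: n m P => // n IH [//|m] P /ltnSE Pn /ltnSE Pm /=.
  by apply: eq_resolve => Q QP; apply: IH;
    [apply: leq_trans Pn|apply: leq_trans Pm].
exists (zn (size L)); apply/funext => P.
by apply: (stab (size L).+1); rewrite ?ltnS ?index_size ?index_mem ?listing_all.
Qed.

Lemma profile_history S : raw_assignment (@avail _ _ _ _ G) S ->
  (forall P, S P <> None) ->
  exists z, complete_history z /\ restriction z S.
Proof.
move=> Sraw Sdef; have [z zE] := resolve_fixpoint S.
have zdef P : z P <> None <-> restriction (contingency P) z.
  rewrite -{1}zE /resolve; case: asboolP => //=; split=> // _; exact: Sdef.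
have zS : restriction z S.
  by move=> P; rewrite -{1 2}zE /resolve; case: asboolP.
exists z; split=> //; apply: completeI; last by move=> P /zdef.
split=> [P a zP|P Q /zdef c cQ]; last by rewrite c.
by apply: Sraw; rewrite -zP zS// zP.
Qed.

(** Filling the gaps with arbitrary available actions lets [profile_history] produce a complete
    history that agrees with [z] wherever both are defined. *)
Lemma profile_through z : raw_assignment (@avail _ _ _ _ G) z ->
  exists S, [/\ raw_assignment (@avail _ _ _ _ G) S, restriction z S &
                forall P, S P <> None].
Proof.
move=> zraw; pose c P := sval (cid (avail_neq0 P)).
exists (fun P => if z P is Some a then Some a else Some (c P)); split.
- move=> P a; case zP: (z P) => [b|] [<-]; first exact: zraw.
  exact: svalP (cid (avail_neq0 P)).
- by move=> P; case: (z P).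
- by move=> P; case: (z P).
Qed.

Lemma complete_history_ex : exists z, @complete_history _ _ _ _ G z.
Proof.
have [//|S [Sraw _ Sdef]] := @profile_through (fun=> None).
by have [z [zC _]] := profile_history Sraw Sdef; exists z.
Qed.

Lemma complete_avail z P a : complete_history z -> z P = Some a -> avail P a.
Proof. by move=> [[zraw _] _]; apply: zraw. Qed.

(* Forcing the coordinates of [P] does reach [P] because consistency makes
   [contingency P] itself a history. *)
Lemma complete_history_through P :
  exists z, complete_history z /\ z P <> None.
Proof.
have [S [Sraw cS Sdef]] := profile_through (@contingency_raw _ _ _ _ G P).
have [z [zC zS]] := profile_history Sraw Sdef.
exists z; split=> //; apply/(complete_defined L P zC) => Q.
have [n] := ubnP (index Q L); elim: n Q => // n IH Q /ltnSE Qn cQ.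
rewrite cS//; apply/esym/zS/(complete_defined L Q zC) => T cT.
have [_ QP] := (contingency_consistent P Q).1 cQ.
rewrite QP// IH//; last by rewrite -QP.
exact: leq_trans (contingency_rank L cT) Qn.
Qed.

(** Overriding [z] at [P] creates no conflict with [z] before [P], so the new history keeps that
    past. The coordinates of [P] lie in it, hence [P] is still reached. *)
Lemma complete_branch z P a : complete_history z -> z P <> None -> avail P a ->
  exists z', [/\ complete_history z', z' P = Some a &
    forall Q, (index Q L < index P L)%N -> z' Q = z Q].
Proof.
move=> zC zP aP.
have wraw : raw_assignment (@avail _ _ _ _ G) (assign z P a).
  move=> Q b; rewrite /assign; case: eqVneq => [-> [<-//]|_].
  exact: complete_avail zC.
have [S [Sraw wS Sdef]] := profile_through wraw.
have [z' [z'C z'S]] := profile_history Sraw Sdef.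
have below Q : (index Q L < index P L)%N -> z' Q = z Q.
  apply: (complete_agree z'C zC) => T b c TP z'T zT.
  have : Some b = Some c; last by case.
  rewrite -z'T -zT z'S ?z'T// -wS /assign; last by case: eqP => //; rewrite zT.
  by case: eqP TP => // ->; rewrite ltnn.
exists z'; split=> //.
have z'P : z' P <> None.
  apply/(complete_defined L P z'C) => Q cQ.
  rewrite below; last exact: contingency_rank cQ.
  exact: (complete_defined L P zC).1 zP _ cQ.
by rewrite z'S// -wS /assign eqxx.
Qed.

(** * Choice nodes as truncated complete histories *)

Lemma truncate0 z : truncate L z 0 = fun=> None.
Proof. by apply/funext. Qed.

Lemma eq_truncate z z' k : (forall Q, (index Q L < k)%N -> z Q = z' Q) ->
  truncate L z k = truncate L z' k.
Proof.
by move=> e; apply/funext => Q; rewrite /truncate; case: ifP => // /e.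
Qed.

Lemma assign_truncate z P a : z P = Some a ->
  assign (truncate L z (index P L)) P a = truncate L z (index P L).+1.
Proof.
move=> zP; apply/funext => Q; rewrite /assign /truncate ltnS.
case: eqVneq => [->|QP]; first by rewrite leqnn zP.
rewrite [in RHS]leq_eqVlt; case: eqP => //= /index_listing_inj QE.
by rewrite QE eqxx in QP.
Qed.

Lemma child_truncate z P : complete_history z -> z P <> None ->
  child L (truncate L z (index P L)) (truncate L z (index P L).+1).
Proof.
move=> zC zP; split; [exact: truncate_node|exact: truncate_node| | |].
- exact: truncate_le.
- by move=> /(congr1 (@^~ P)); rewrite /truncate ltnn ltnSn => /esym.
- move=> g _ /Defs.prefixE[i hi] /Defs.prefixE[j]; rewrite truncate_truncate => gE.
  have [jP|Pj] := leqP j (index P L); last by right; rewrite gE (minn_idPr Pj).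
  left; rewrite (minn_idPl (leqW jP)) in gE; apply/funext => Q.
  have [Qj|jQ] := ltnP (index Q L) j.
    by rewrite gE /truncate Qj (leq_trans Qj jP).
  by rewrite hi gE truncate_truncate /truncate leq_min (ltnNge _ j) jQ andbF.
Qed.

Lemma choice_node_truncate z P : complete_history z -> z P <> None ->
  choice_node L (truncate L z (index P L)).
Proof.
move=> zC zP; have [//|[_ hmax]] := truncate_node L (index P L) zC.
exfalso; apply: hmax; exists z; split; first by case: zC.
- by move=> Q; rewrite /truncate; case: ifP.
- by exists P; split=> //; rewrite /truncate ltnn.
Qed.

(** The choice behind [decision_point] is opaque, but the cut just after [P] is a child that differs
    from [h] at [P], and a child differs from its parent only at the decision point. *)
Lemma decision_point_truncate (h : {h | choice_node L h}) z P :
  complete_history z -> z P <> None -> sval h = truncate L z (index P L) ->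
  decision_point h = P.
Proof.
move=> zC zP hz; rewrite /decision_point; case: cid => /= P' [_ hP'].
have [|_ _ eqP'] := hP' (truncate L z (index P L).+1).
  by rewrite hz; exact: child_truncate.
apply/eqP/negPn/negP => PP'; apply: zP.
move: (eqP' P); rewrite eq_sym => /(_ PP').
by rewrite hz /truncate ltnn ltnSn.
Qed.

Lemma choice_nodeP (h : {h | choice_node L h}) :
  exists z, [/\ complete_history z, z (decision_point h) <> None &
                sval h = truncate L z (index (decision_point h) L)].
Proof.
have [_ hI [z [zC /Defs.prefixE[k hz]]]] := svalP h.
have [P0 P0P] : exists P, z P && ~~ sval h P.
  apply: contrapT => nP; apply: hI; suff -> : sval h = z by [].
  apply/funext => P; rewrite hz /truncate; case: ltnP => // kP.
  case zP : (z P) => [a|] //; case: nP; exists P.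
  by rewrite zP hz /truncate ltnNge kP.
have [P /andP[zP hP] Pmin] :=
  @arg_minnP _ P0 (fun P => z P && ~~ sval h P) (fun P => index P L) P0P.
have {}zP : z P <> None by move: zP; case: (z P).
(* Moving the cut from [k] on to [P] has no effect: minimality of [P] leaves [z] undefined in
   between. *)
have hE : sval h = truncate L z (index P L).
  apply/funext => Q; rewrite [RHS]/truncate; case: ltnP => QP.
    move: (Pmin Q); rewrite leqNgt QP hz /truncate; case: ifP => // _.
    by case: (z Q) => //= a /(_ isT).
  rewrite hz /truncate; case: ltnP => // Qk.
  move: hP; rewrite hz /truncate (leq_ltn_trans QP Qk).
  by case: (z P) zP.
by exists z; rewrite (decision_point_truncate zC zP hE).
Qed.

Definition node_val (x : {h | choice_node L h} +
    {h : assignment (dpoint G) A | complete_history h}) :=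
  match x with inl h => sval h | inr z => sval z end.

Lemma node_val_tree x : tree_node L (node_val x).
Proof. by case: x => x; [left|right]; apply: svalP. Qed.

(** No choice node is complete, so the assignment alone determines the summand; equality of nodes
    can then be tested on assignments. *)
Lemma to_nodeE h x : to_node L h = Some x <-> node_val x = h.
Proof.
rewrite /to_node; case: (pselect (choice_node L h)) => [hN|hN].
  split=> [[<-]//|]; case: x => [[g gN]|[g gC]] /= E; subst g.
    by do 2 f_equal; apply: eq_exist.
  by have [_] := hN.
case: (pselect (complete_history h)) => [hC|hC].
  split=> [[<-]//|]; case: x => [[g gN]|[g gC]] /= E; subst g => //.
  by do 2 f_equal; apply: eq_exist.
by split=> // E; have := node_val_tree x; rewrite E => -[].
Qed.

Lemma node_val_inj x y : node_val x = node_val y -> x = y.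
Proof.
move=> /to_nodeE xy; have /to_nodeE := erefl (node_val y); by rewrite xy => -[].
Qed.

Lemma node_val_ex h : tree_node L h -> exists x, node_val x = h.
Proof. by case=> hN; [exists (inl (exist _ h hN))|exists (inr (exist _ h hN))]. Qed.

End Histories.

(** * The successor tree and its strategic form *)

Section Tree.
Context (R : realType) (d : nat) (N A : Type) (G : spacetime_game R d N A).
Context (L : linearization G).
Local Notation E := (extensive_of L).
Local Notation succ := (@ef_succ _ _ _ E).
Implicit Types (h : {h | choice_node L h}) (x y r : ef_node E) (P Q : dpoint G).

Lemma ef_succE h a : succ h a =
  if `[< avail (decision_point h) a >]
  then to_node L (assign (sval h) (decision_point h) a) else None.
Proof. by []. Qed.

(** The complete history behind [h] may take an action other than [a]; [complete_branch] replaces it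
    by one that takes [a] and has the same cut. *)
Lemma succ_truncate h a y : succ h a = Some y <->
  exists z, [/\ complete_history z, z (decision_point h) = Some a,
    sval h = truncate L z (index (decision_point h) L) &
    node_val y = truncate L z (index (decision_point h) L).+1].
Proof.
rewrite ef_succE; split; last first.
  move=> [z [zC za hz yz]]; rewrite asboolT; last exact: complete_avail za.
  by apply/to_nodeE; rewrite hz assign_truncate.
case: asboolP => // aP /to_nodeE yE.
have [z [zC zP hz]] := choice_nodeP h.
have [z' [z'C z'P z'z]] := complete_branch L zC zP aP.
have hz' : sval h = truncate L z' (index (decision_point h) L).
  by rewrite hz; apply: eq_truncate => Q /z'z.
by exists z'; split=> //; rewrite yE {1}hz' assign_truncate.
Qed.

Lemma succ_defined h a : succ h a <> None <-> avail (decision_point h) a.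
Proof.
split=> [|aP]; first by rewrite ef_succE; case: asboolP.
have [z [zC zP hz]] := choice_nodeP h.
have [z' [z'C z'P z'z]] := complete_branch L zC zP aP.
have [y yE] := node_val_ex (truncate_node L (index (decision_point h) L).+1 z'C).
suff -> : succ h a = Some y by [].
apply/succ_truncate; exists z'; split=> //.
by rewrite hz; apply: eq_truncate => Q /z'z.
Qed.

Lemma succE h a y : succ h a = Some y ->
  node_val y = assign (sval h) (decision_point h) a.
Proof. by rewrite ef_succE; case: asboolP => // _ /to_nodeE. Qed.

Lemma choice_after h Q :
  (index (decision_point h) L <= index Q L)%N -> sval h Q = None.
Proof.
have [z [_ _ hz]] := choice_nodeP h.
by rewrite leqNgt hz /truncate => /negbTE ->.
Qed.

(** A choice node is undefined from its decision point on, so the last assigned point of [y] in the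
    listing is the decision point of its parent; erasing that entry gives back the parent. *)
Lemma succ_inj h h' a a' y : succ h a = Some y -> succ h' a' = Some y ->
  h = h' /\ a = a'.
Proof.
move=> /succE yE /succE; rewrite yE => {y yE} e.
have le (g g' : {h | choice_node L h}) b b' : assign (sval g) (decision_point g) b =
    assign (sval g') (decision_point g') b' ->
    (index (decision_point g) L <= index (decision_point g') L)%N.
  move=> /(congr1 (@^~ (decision_point g))); rewrite /assign eqxx.
  case: eqP => [->//|_]; case: leqP => // PP'.
  by rewrite choice_after// ltnW.
have PE : decision_point h = decision_point h'.
  apply: (@index_listing_inj _ _ _ _ _ L); apply/eqP.
  by rewrite eqn_leq (le _ _ _ _ e) (le _ _ _ _ (esym e)).
have eQ Q : assign (sval h) (decision_point h) a Q =
    assign (sval h') (decision_point h') a' Q by rewrite e.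
split; last by have := eQ (decision_point h); rewrite /assign PE eqxx => -[].
suff: @inl _ (ef_outcome E) h = inl h' by case.
apply: node_val_inj; apply/funext => Q /=; have := eQ Q; rewrite /assign -PE.
by case: eqP => // -> _; rewrite !choice_after// PE.
Qed.

(** With [step] abstract, one induction on the cut serves both the edges of the tree and the moves
    prescribed by a profile. *)
Lemma truncate_reachable z (step : ef_node E -> ef_node E -> Prop) r x k :
  complete_history z ->
  (forall h a y, z (decision_point h) = Some a -> succ h a = Some y ->
    step (inl h) y) ->
  node_val r = (fun=> None) -> node_val x = truncate L z k ->
  clos_refl_trans _ step r x.
Proof.
move=> zC zstep r0; elim: k x => [|k IH] x xz.
  rewrite (@node_val_inj _ _ _ _ _ _ x r); first exact: rt_refl.
  by rewrite r0 xz truncate0.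
case: (pselect (exists2 P, index P L = k & z P <> None)) => [[P Pk zP]|nP].
  rewrite -Pk in IH xz.
  have [a za] : exists a, z P = Some a by case: (z P) zP => [a|] //; exists a.
  pose h := exist (choice_node L) _ (choice_node_truncate L zC zP).
  have hP : decision_point h = P by apply: (decision_point_truncate zC zP).
  apply: (@rt_trans _ _ _ (inl h)); first exact: IH.
  apply/rt_step/(zstep h a); first by rewrite hP.
  by apply/succ_truncate; exists z; rewrite hP.
(* No action of [z] sits at position [k], so the cuts at [k] and [k.+1] are the same node and no
   move is made. *)
apply: IH; rewrite xz; apply/funext => P; rewrite /truncate ltnS leq_eqVlt.
case: eqP => //= Pk; rewrite Pk ltnn; apply: contrapT => zP.
by apply: nP; exists P.
Qed.

Lemma edge_reachable r x : node_val r = (fun=> None) ->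
  clos_refl_trans _ (@ef_edge _ _ _ E) r x.
Proof.
move=> r0; have [z [k [zC xz]]] := node_truncate (node_val_tree x).
by apply: (truncate_reachable zC _ r0 xz) => h a y _ hy; exists h, a.
Qed.

Lemma empty_node_ex : exists r, node_val r = (fun=> None).
Proof.
have [z zC] := complete_history_ex L.
by have [r rE] := node_val_ex (truncate_node L 0 zC); exists r; rewrite rE truncate0.
Qed.

(** A path of positive length from the empty node would end with an edge into the root. Conversely,
    a successor is defined at the decision point of its parent, hence not empty. *)
Lemma rootE r : ef_root r <-> node_val r = (fun=> None).
Proof.
split=> [rroot|r0 [x [h [a [_ /succE]]]]]; last first.
  rewrite r0 => /(congr1 (@^~ (decision_point h))).
  by rewrite /assign eqxx.
have [r' r'0] := empty_node_ex.
have := clos_rt_rtn1 _ _ _ _ (edge_reachable r r'0).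
by move=> rr; case: rr rroot => // y x yx _ []; exists y.
Qed.

(** Each move of a play adds an action of the profile, so all its nodes restrict the profile.
    Conversely, a complete history that restricts the profile is reached cut by cut. *)
Lemma reaches_restriction (s : N -> assignment (dpoint G) A) (z : ef_outcome E) :
  (forall P, s (agent P) P <> None) ->
  @ef_reaches _ _ _ E s z <-> restriction (sval z) (fun P => s (agent P) P).
Proof.
move=> sdef; split=> [[r [/rootE r0 rz]]|zs].
  suff: restriction (node_val (inr z : ef_node E)) (fun P => s (agent P) P) by [].
  elim: (clos_rt_rtn1 _ _ _ _ rz) => [|x y [h [k [a [-> hk sa /succE yE]]]] _ IH].
    by rewrite r0.
  move: hk sa => /= <- sa P; rewrite yE /assign.
  by case: eqP => [->//|_]; apply: IH.
have [r r0] := empty_node_ex; exists r; split; first exact/rootE.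
have zC := svalP z.
apply: (truncate_reachable (k := size L) zC _ r0) => [h a y za hy|].
  exists h, (decision_point h), a; split=> //=.
  by rewrite -zs za.
by apply/funext => P; rewrite /truncate index_mem listing_all.
Qed.

Lemma infoset_neq0 (P : dpoint G) :
  exists h : {h | choice_node L h}, decision_point h = P.
Proof.
have [z [zC zP]] := complete_history_through L P.
exists (exist _ _ (choice_node_truncate L zC zP));
  by apply: (decision_point_truncate zC zP).
Qed.

Lemma extensive_of_game : extensive_game E.
Proof.
split.
- exact: succ_defined.
- exact: succ_inj.
- have [r r0] := empty_node_ex; exists r; split; last first.
    by move=> x; apply: edge_reachable.
  split; first exact/rootE.
  by move=> r' /rootE r'0; apply: node_val_inj; rewrite r0 r'0.
- exact: infoset_neq0.
- by move=> h; exists (decision_point h); split=> // k.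
- move=> P Q /= PQ [] ?; exact: dindexP.
- by move=> k h /= ->.
- by move=> k h h' /= -> ->.
Qed.

(** The tree constrains an action only through the nodes of its information set; nonemptiness of
    that set carries the constraint back to the decision point. *)
Lemma ef_strategyE i : ef_strategy (E := E) i = strategy (G := G) i.
Proof.
apply/seteqP; split=> s [/= s1 s2]; split=> //.
  by move=> P a sP; have [h hP] := infoset_neq0 P; have := s2 P a h sP hP;
    rewrite /= hP.
by move=> P a h sP /= hP; rewrite hP; apply: s1.
Qed.

Lemma profile_outcome (s : forall i, {x | strategy (G := G) i x}) :
  exists z : {h | complete_history h},
    unique (fun z' : {h | complete_history h} =>
      restriction (sval z') (fun P => sval (s (agent P)) P)) z.
Proof.
have [|P|z [zC zs]] :=
    @profile_history _ _ _ _ G L (fun P => sval (s (agent P)) P).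
- by move=> P a; have [sraw _] := svalP (s (agent P)); apply: sraw.
- by have [_ sdef] := svalP (s (agent P)); apply/sdef.
exists (exist _ z zC); split=> // -[z' z'C] /= z's.
by apply: eq_exist; exact: (complete_restriction_inj L zC z'C zs z's).
Qed.

End Tree.

Theorem theorem3 (R : realType) (d : nat) (hd : (2 <= d)%N) (N A : Type)
    (G : spacetime_game R d N A) (L : linearization G) :
  extensive_game (extensive_of L) /\
  exists F : normal_form R N (assignment (dpoint G) A),
    strategic_form G F /\ ef_strategic_form (extensive_of L) F.
Proof.
split; first exact: extensive_of_game.
exists {| nf_strategy := fun i => strategy (G := G) i;
  nf_payoff := fun s i => payoff i (sval (cid (profile_outcome L s))) |}.
split; split=> /=.
- by [].
- move=> s; exists (sval (cid (profile_outcome L s))); split=> //.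
  exact: svalP (cid (profile_outcome L s)).
- by move=> i; rewrite ef_strategyE.
- move=> s; have [zs zuniq] := svalP (cid (profile_outcome L s)).
  have sdef P : sval (s (agent P)) P <> None.
    by have [_ sdef] := svalP (s (agent P)); apply/sdef.
  (* Play and resolution select the same histories, so existence and uniqueness transfer to the
     tree. *)
  have reach z := @reaches_restriction _ _ _ _ _ L (fun i => sval (s i)) z sdef.
  exists (sval (cid (profile_outcome L s))); split=> //.
  by split=> [|z' /reach /zuniq//]; apply/reach.
Qed.
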